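(* Let $\lambda,\mu\in\mathbb F$ with $\mu\neq0$ and $\mu\neq1$. Then the $\mathrm{ad}(A_\omega^\delta)$-module $(V,\psi_{\lambda\mu})$ cannot be induced by any 3-Lie algebra $A_\omega^\delta$-module; that is, it is not an induced module.
   Context: $\mathbb F$ is a field of characteristic zero (so $\mathbb Z\subset\mathbb F$); all vector spaces and algebras are over $\mathbb F$. A 3-Lie algebra is a vector space $B$ with a linear map $[\,,\,,\,]:B\wedge B\wedge B\to B$ satisfying $[x_1,x_2,[x_3,x_4,x_5]]=[[x_1,x_2,x_3],x_4,x_5]+[x_3,[x_1,x_2,x_4],x_5]+[x_3,x_4,[x_1,x_2,x_5]]$. For $x,y\in B$, $\mathrm{ad}(x,y)(z)=[x,y,z]$; the inner derivation algebra $\mathrm{ad}(B)$ is the Lie algebra (under the commutator) of all linear combinations of the maps $\mathrm{ad}(x,y)$. A module of a 3-Lie algebra $B$ is a pair $(W,\rho)$, with $W$ a vector space and $\rho:B\wedge B\to gl(W)$ linear, such that for all $x_i\in B$: $[\rho(x_1,x_2),\rho(x_3,x_4)]=\rho([x_1,x_2,x_3],x_4)+\rho(x_3,[x_1,x_2,x_4])$ and $\rho([x_1,x_2,x_3],x_4)=\rho(x_1,x_2)\rho(x_3,x_4)+\rho(x_2,x_3)\rho(x_1,x_4)+\rho(x_3,x_1)\rho(x_2,x_4)$. Induced modules: for a $B$-module $(W,\rho)$, let $L_\rho(W)$ be the linear span of $\{\rho(x,y)\mid x,y\in B\}$, a Lie subalgebra of $gl(W)$. If the center $Z(L_\rho(W))$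 is $0$, there is a well-defined linear map $\bar\rho:\mathrm{ad}(B)\to gl(W)$ with $\bar\rho(\mathrm{ad}(x,y))=\rho(x,y)$ for all $x,y\in B$, and $(W,\bar\rho)$ is an $\mathrm{ad}(B)$-module, called the induced module associated with the $B$-module $(W,\rho)$. An $\mathrm{ad}(B)$-module is an induced module if it equals $(W,\bar\rho)$ for some such $B$-module $(W,\rho)$. $A_\omega^\delta$ is the (simple) 3-Lie algebra with basis $\{L_r,M_r\mid r\in\mathbb Z\}$ and (skew-symmetric) bracket determined by $[L_r,L_s,M_t]=(s-r)L_{r+s-t}$, $[L_r,M_s,M_t]=(t-s)M_{s+t-r}$ for $r,s,t\in\mathbb Z$, all other brackets of basis elements (i.e. $[L_r,L_s,L_t]$ and $[M_r,M_s,M_t]$) being zero. It is known that $\mathrm{ad}(A_\omega^\delta)$ has a basis $\{p_r,q_r,x_r,z_r\mid r\in\mathbb Z\}$, where for $r\neq0$: $p_r=\frac12(\mathrm{ad}(L_0,M_{-r})+\mathrm{ad}(L_r,M_0))$, $q_r=\frac1r(\mathrm{ad}(L_0,M_{-r})-\mathrm{ad}(L_r,M_0))$, $x_r=\frac1r\mathrm{ad}(L_r,L_0)$, $z_r=\frac1{-r}\mathrm{ad}(M_{-r},M_0)$; and $p_0=\mathrm{ad}(L_0,M_0)$, $q_0=\mathrm{ad}(L_0,M_0)-\mathrm{ad}(L_1,M_1)$, $x_0=\frac12\mathrm{ad}(L_1,L_{-1})$, $z_0=\frac12\mathrm{ad}(M_1,M_{-1})$. The Lie brackets are: $[p_r,p_s]=(r-s)p_{r+s}$,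 $[p_r,q_s]=-sq_{r+s}$, $[p_r,x_s]=-sx_{r+s}$, $[p_r,z_s]=-sz_{r+s}$, $[q_r,x_s]=-2x_{r+s}$, $[q_r,z_s]=2z_{r+s}$, $[z_r,x_s]=q_{r+s}$, the others being zero. $V=\sum_{\alpha\in\mathbb F}\mathbb F v_\alpha$ is the vector space with basis $\{v_\alpha\mid\alpha\in\mathbb F\}$. For $\lambda,\mu\in\mathbb F$, $\psi_{\lambda\mu}:\mathrm{ad}(A_\omega^\delta)\to gl(V)$ is the linear map with $\psi_{\lambda\mu}(p_r)v_\alpha=(\lambda+\alpha-r\mu)v_{\alpha-r}$, $\psi_{\lambda\mu}(q_r)v_\alpha=\psi_{\lambda\mu}(x_r)v_\alpha=\psi_{\lambda\mu}(z_r)v_\alpha=0$ ($r\in\mathbb Z$, $\alpha\in\mathbb F$); it makes $V$ an $\mathrm{ad}(A_\omega^\delta)$-module. *)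

(* Defs.v *)
(* The classical axioms of boolp turn the linear endomorphisms of a
   space, and the subspaces they span, into vector spaces. *)
From HB Require Import structures.
From mathcomp Require Import all_boot all_order all_algebra.
From mathcomp Require Import boolp.
From mathcomp Require Import finmap monalg.
From mathcomp Require Import ring.

Set Implicit Arguments.
Unset Strict Implicit.
Unset Printing Implicit Defensive.

Import GRing.Theory.
Local Open Scope ring_scope.

(* gl(W); as a ring its product is composition. *)
Definition gl (F : fieldType) (W : lmodType F) : Type := {linear W -> W}.

HB.instance Definition _ (F : fieldType) (W : lmodType F) :=
  gen_eqMixin (gl W).
HB.instance Definition _ (F : fieldType) (W : lmodType F) :=
  gen_choiceMixin (gl W).

Section GeneralLinear.
Variables (F : fieldType) (W : lmodType F).
Implicit Types f g h : gl W.

Lemma glP f g : (forall w, f w = g w) <-> f = g.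
Proof.
split=> [fg | -> //].
case: f g fg => [f cf] [g cg] /= /funext fg.
case: _ / fg cg => cg.
congr GRing.Linear.Pack; case: cf cg => [[a] [b]] [[c] [d]].
by congr GRing.Linear.Class;
  rewrite (Prop_irrelevance a c, Prop_irrelevance b d).
Qed.

Definition gl_zero : gl W := \0.
Definition gl_opp f : gl W := -1 \*: f.
Definition gl_add f g : gl W := f \+ g.
Definition gl_scale (a : F) f : gl W := a \*: f.
Definition gl_one : gl W := idfun.
Definition gl_mul f g : gl W := f \o g.

Fact gl_addA : associative gl_add.
Proof. by move=> f g h; apply/glP=> w /=; rewrite addrA. Qed.
Fact gl_addC : commutative gl_add.
Proof. by move=> f g; apply/glP=> w /=; rewrite addrC. Qed.
Fact gl_add0 : left_id gl_zero gl_add.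
Proof. by move=> f; apply/glP=> w /=; rewrite add0r. Qed.
Fact gl_addN : left_inverse gl_zero gl_opp gl_add.
Proof. by move=> f; apply/glP=> w /=; rewrite scaleN1r addNr. Qed.

HB.instance Definition _ :=
  GRing.isZmodule.Build (gl W) gl_addA gl_addC gl_add0 gl_addN.

Fact gl_mulA : associative gl_mul.
Proof. by move=> f g h; apply/glP. Qed.
Fact gl_mul1 : left_id gl_one gl_mul.
Proof. by move=> f; apply/glP. Qed.
Fact gl_1mul : right_id gl_one gl_mul.
Proof. by move=> f; apply/glP. Qed.
Fact gl_mulDl : left_distributive gl_mul +%R.
Proof. by move=> f g h; apply/glP. Qed.
Fact gl_mulDr : right_distributive gl_mul +%R.
Proof. by move=> f g h; apply/glP=> w /=; rewrite linearD. Qed.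

HB.instance Definition _ :=
  GRing.Zmodule_isPzRing.Build (gl W) gl_mulA gl_mul1 gl_1mul gl_mulDl gl_mulDr.

Fact gl_scaleA a b f : gl_scale a (gl_scale b f) = gl_scale (a * b) f.
Proof. by apply/glP=> w /=; rewrite scalerA. Qed.
Fact gl_scale1 : left_id 1 gl_scale.
Proof. by move=> f; apply/glP=> w /=; rewrite scale1r. Qed.
Fact gl_scaleDr : right_distributive gl_scale +%R.
Proof. by move=> a f g; apply/glP=> w /=; rewrite scalerDr. Qed.
Fact gl_scaleDl f : {morph gl_scale^~ f : a b / a + b}.
Proof. by move=> a b; apply/glP=> w /=; rewrite scalerDl. Qed.

HB.instance Definition _ :=
  GRing.Zmodule_isLmodule.Build F (gl W)
    gl_scaleA gl_scale1 gl_scaleDr gl_scaleDl.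

Lemma gl0E w : (0 : gl W) w = 0. Proof. by []. Qed.
Lemma glDE f g w : (f + g) w = f w + g w. Proof. by []. Qed.
Lemma glNE f w : (- f) w = - f w. Proof. exact: scaleN1r. Qed.
Lemma glBE f g w : (f - g) w = f w - g w. Proof. by rewrite glDE glNE. Qed.
Lemma glZE a f w : (a *: f) w = a *: f w. Proof. by []. Qed.
Lemma glME f g w : (f * g) w = f (g w). Proof. by []. Qed.
Definition glE := (gl0E, glDE, glNE, glZE, glME).

Definition lie f g : gl W := f * g - g * f.

Lemma lieE f g w : lie f g w = f (g w) - g (f w).
Proof. by rewrite glBE. Qed.

Fact lie_linearl g : linear (lie^~ g).
Proof.
move=> a f f'; rewrite /lie mulrDl mulrDr opprD addrACA scalerBr.
by congr (_ - _ + _); apply/glP=> w; rewrite !glE // linearZ.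
Qed.

Fact lie_linearr f : linear (lie f).
Proof.
move=> a g g'; rewrite /lie mulrDl mulrDr opprD addrACA scalerBr.
by congr (_ - _ + _); apply/glP=> w; rewrite !glE // linearZ.
Qed.

End GeneralLinear.

(* The linear span of a family e, as a subspace. *)
Definition lin_span (F : fieldType) (V : lmodType F) (I : Type) (e : I -> V) :
    {pred V} :=
  [pred v | `[< exists s : seq (F * I), v = \sum_(t <- s) t.1 *: e t.2 >]].

Section LinSpan.
Variables (F : fieldType) (V : lmodType F) (I : Type) (e : I -> V).

Fact lin_span_submod : submod_closed (lin_span e).
Proof.
split; first by apply/asboolP; exists [::]; rewrite big_nil.
move=> a _ _ /asboolP[s ->] /asboolP[t ->]; apply/asboolP.
exists ([seq (a * x.1, x.2) | x <- s] ++ t).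
rewrite big_cat big_map scaler_sumr; congr (_ + _).
by apply: eq_bigr => x _; rewrite scalerA.
Qed.

HB.instance Definition _ :=
  GRing.isSubmodClosed.Build F V (lin_span e) lin_span_submod.

Lemma mem_lin_span i : e i \in lin_span e.
Proof.
by apply/asboolP; exists [:: (1, i)]; rewrite big_seq1 scale1r.
Qed.

End LinSpan.

HB.mixin Record isThreeLie (F : fieldType) (B : Type)
    of GRing.Lmodule F B := {
  br3 : B -> B -> B -> B;
  br3_linear1 : forall y z, linear (fun x => br3 x y z);
  br3_linear2 : forall x z, linear (fun y => br3 x y z);
  br3_linear3 : forall x y, linear (br3 x y);
  br3_alt12 : forall x z, br3 x x z = 0;
  br3_alt23 : forall x y, br3 x y y = 0;
  br3_fundamental : forall x1 x2 x3 x4 x5,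
    br3 x1 x2 (br3 x3 x4 x5) =
      br3 (br3 x1 x2 x3) x4 x5 + br3 x3 (br3 x1 x2 x4) x5
        + br3 x3 x4 (br3 x1 x2 x5)
}.

#[short(type="threeLieType")]
HB.structure Definition ThreeLie (F : fieldType) :=
  { B of GRing.Lmodule F B & isThreeLie F B }.

Section InnerDerivations.
Variables (F : fieldType) (B : threeLieType F).

Section Ad.
Variables x y : B.
Definition ad_fun (z : B) : B := br3 x y z.
HB.instance Definition _ :=
  GRing.isLinear.Build F B B *:%R ad_fun (br3_linear3 x y).
Definition ad : gl B := ad_fun.
End Ad.

Definition inner_derivation : {pred gl B} :=
  lin_span (fun t : B * B => ad t.1 t.2).
HB.instance Definition _ :=
  GRing.isSubmodClosed.Build F (gl B) inner_derivation (lin_span_submod _).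

(* ad(B), as a type; inn x y below is ad(x, y) as an element of it. *)
Record ad_alg : Type :=
  AdAlg { ad_val : gl B; _ : ad_val \in inner_derivation }.
HB.instance Definition _ := [isSub for ad_val].
HB.instance Definition _ := [Choice of ad_alg by <:].
HB.instance Definition _ :=
  [SubChoice_isSubLmodule of ad_alg by <:].

Definition inn (x y : B) : ad_alg :=
  AdAlg (mem_lin_span (fun t : B * B => ad t.1 t.2) (x, y)).

Lemma ad_fundamental x1 x2 x3 x4 :
  lie (ad x1 x2) (ad x3 x4) = ad (br3 x1 x2 x3) x4 + ad x3 (br3 x1 x2 x4).
Proof.
by apply/glP=> z; rewrite lieE glDE /= /ad_fun br3_fundamental addrK.
Qed.

Fact ad_linearl y : linear (fun x => ad x y).
Proof. by move=> a x x'; apply/glP => z; rewrite glE; apply: br3_linear1. Qed.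

Fact ad_linearr x : linear (ad x).
Proof. by move=> a y y'; apply/glP => z; rewrite glE; apply: br3_linear2. Qed.

Fact ad_lie_subproof (D E : ad_alg) :
  lie (\val D) (\val E) \in inner_derivation.
Proof.
have /asboolP[s ->] : \val D \in inner_derivation by case: D.
have /asboolP[t ->] : \val E \in inner_derivation by case: E.
pose lie_l (g : gl B) :=
  GRing.isLinear.Build F (gl B) (gl B) *:%R (fun f => lie f g) (lie_linearl g).
pose lie_r (f : gl B) :=
  GRing.isLinear.Build F (gl B) (gl B) *:%R (lie f) (lie_linearr f).
pose ll g : {linear gl B -> gl B} := HB.pack (fun f => lie f g) (lie_l g).
pose lr f : {linear gl B -> gl B} := HB.pack (lie f) (lie_r f).
rewrite -[lie _ _]/(ll _ _) linear_sum rpred_sum // => x _.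
rewrite linearZ rpredZ //= -[lie _ _]/(lr _ _) linear_sum rpred_sum // => y _.
rewrite linearZ rpredZ //= ad_fundamental rpredD //;
  exact: (mem_lin_span (fun t : B * B => ad t.1 t.2) (_, _)).
Qed.

Definition ad_lie (D E : ad_alg) : ad_alg := AdAlg (ad_lie_subproof D E).

Fact inn_linearl y : linear (fun x => inn x y).
Proof.
by move=> a x x'; apply: val_inj; rewrite [RHS]linearP; apply: ad_linearl.
Qed.

Fact inn_linearr x : linear (inn x).
Proof.
by move=> a y y'; apply: val_inj; rewrite [RHS]linearP; apply: ad_linearr.
Qed.

Fact ad_lie_linearl E : linear (fun D => ad_lie D E).
Proof.
move=> a D D'; apply: val_inj; rewrite [RHS]linearP /= -lie_linearl.
by congr lie; rewrite -linearP.
Qed.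

Fact ad_lie_linearr D : linear (ad_lie D).
Proof.
move=> a E E'; apply: val_inj; rewrite [RHS]linearP /= -lie_linearr.
by congr lie; rewrite -linearP.
Qed.

Lemma ad_lie_inn x1 x2 x3 x4 :
  ad_lie (inn x1 x2) (inn x3 x4) =
    inn (br3 x1 x2 x3) x4 + inn x3 (br3 x1 x2 x4).
Proof. by apply: val_inj; rewrite [RHS]linearD; apply: ad_fundamental. Qed.

Lemma ad_alg_ext (U : lmodType F) (g h : ad_alg -> U) :
  linear g -> linear h -> (forall x y, g (inn x y) = h (inn x y)) -> g =1 h.
Proof.
move=> gl hl gh D.
have /asboolP[s Ds] : \val D \in inner_derivation by case: D.
have -> : D = \sum_(t <- s) t.1 *: inn t.2.1 t.2.2.
  by apply: val_inj; rewrite linear_sum Ds; apply: eq_bigr => t _; rewrite linearZ.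
pose G : {linear _ -> _} := HB.pack g (GRing.isLinear.Build F _ _ _ g gl).
pose H : {linear _ -> _} := HB.pack h (GRing.isLinear.Build F _ _ _ h hl).
rewrite -[LHS]/(G _) -[RHS]/(H _) !linear_sum.
by apply: eq_bigr => t _; rewrite !linearZ /= gh.
Qed.

End InnerDerivations.

Section Modules.
Variables (F : fieldType) (B : threeLieType F) (W : lmodType F).

(* (W, rho) is a B-module; rho : B /\ B -> gl(W) is given as an alternating
   bilinear map. *)
Definition is_3Lie_module (rho : B -> B -> gl W) : Prop :=
  [/\ forall y, linear (rho^~ y),
      forall x, linear (rho x),
      forall x, rho x x = 0,
      forall x1 x2 x3 x4,
        lie (rho x1 x2) (rho x3 x4) =
          rho (br3 x1 x2 x3) x4 + rho x3 (br3 x1 x2 x4)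
    & forall x1 x2 x3 x4,
        rho (br3 x1 x2 x3) x4 =
          rho x1 x2 * rho x3 x4 + rho x2 x3 * rho x1 x4
            + rho x3 x1 * rho x2 x4].

Definition L_rho (rho : B -> B -> gl W) : {pred gl W} :=
  lin_span (fun t : B * B => rho t.1 t.2).

Definition center_free (L : {pred gl W}) : Prop :=
  forall f, f \in L -> (forall g, g \in L -> lie f g = 0) -> f = 0.

Definition is_ad_module (psi : {linear ad_alg B -> gl W}) : Prop :=
  forall D E, psi (ad_lie D E) = lie (psi D) (psi E).

(* psi is the map induced by some B-module (W, rho): the generators inn x y
   span ad(B), so the last condition says that psi is the map rho-bar. *)
Definition is_induced (psi : {linear ad_alg B -> gl W}) : Prop :=
  exists rho : B -> B -> gl W,
    [/\ is_3Lie_module rho, center_free (L_rho rho)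
      & forall x y, psi (inn x y) = rho x y].

End Modules.

(* The basis vector << k >> of the free module {malg F[K]}; it is locked to keep
   unification from unfolding it. *)
HB.lock
Definition basis_vec (F : fieldType) (K : choiceType) (k : K) : {malg F[K]} :=
  << k >>.

Notation "''b_' k" := (basis_vec _ k) (at level 8, k at level 2).

Section Extension.
Variables (F : fieldType) (K : choiceType) (W : lmodType F).
Implicit Types (f g : K -> W) (x y : {malg F[K]}).

(* Linear extension from the basis 'b_k of the free module. *)
Definition lext f x : W := \sum_(k <- msupp x) x@_k *: f k.

Lemma lextE (d : {fset K}) f x :
  fsubset (msupp x) d -> lext f x = \sum_(k <- d) x@_k *: f k.
Proof.
move=> xd; rewrite /lext; apply: big_fset_incl => // k _ /mcoeff_outdom ->.
by rewrite scale0r.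
Qed.

Fact lext_is_linear f : linear (lext f).
Proof.
move=> a x y; pose d := fsetU (fsetU (msupp x) (msupp y)) (msupp (a *: x + y)).
have dx : fsubset (msupp x) d by rewrite /d -fsetUA fsubsetUl.
have dy : fsubset (msupp y) d by rewrite /d fsetUAC fsubsetUr.
rewrite (lextE _ dx) (lextE _ dy) (@lextE d) ?fsubsetUr //.
rewrite scaler_sumr -big_split /=; apply: eq_bigr => k _.
by rewrite mcoeffD mcoeffZ scalerDl scalerA.
Qed.
HB.instance Definition _ f :=
  GRing.isLinear.Build F {malg F[K]} W *:%R (lext f) (lext_is_linear f).

Lemma eq_lext f g : f =1 g -> lext f =1 lext g.
Proof. by move=> fg x; apply: eq_bigr => k _; rewrite fg. Qed.

Lemma lext_lin a f g x :
  lext (fun k => a *: f k + g k) x = a *: lext f x + lext g x.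
Proof.
rewrite /lext scaler_sumr -big_split /=; apply: eq_bigr => k _.
by rewrite scalerDr !scalerA mulrC.
Qed.

Lemma lextU f k : lext f 'b_k = f k.
Proof. by rewrite unlock (lextE f msuppU_le) big_seq_fset1 mcoeffUU scale1r. Qed.

Lemma malg_basis x : x = \sum_(k <- msupp x) x@_k *: 'b_k.
Proof.
rewrite {1}[x]monalgE; apply: eq_bigr => k _; rewrite unlock; apply/malgP => l.
by rewrite mcoeffZ !mcoeffU mulrnAr mulr1.
Qed.

Lemma malg_ext (g h : {malg F[K]} -> W) :
  linear g -> linear h -> (forall k, g 'b_k = h 'b_k) -> g =1 h.
Proof.
move=> gl hl gh x.
pose G : {linear _ -> _} := HB.pack g (GRing.isLinear.Build F _ _ _ g gl).
pose H : {linear _ -> _} := HB.pack h (GRing.isLinear.Build F _ _ _ h hl).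
rewrite -[g x]/(G x) -[h x]/(H x) [x]malg_basis !linear_sum.
by apply: eq_bigr => k _; rewrite !linearZ /= gh.
Qed.

Section Alternating.
Variable b : {malg F[K]} -> {malg F[K]} -> W.
Hypotheses (bl : forall y, linear (b^~ y)) (br : forall x, linear (b x)).
Hypothesis bkk : forall k, b 'b_k 'b_k = 0.
Hypothesis bkl : forall k l, b 'b_k 'b_l = - b 'b_l 'b_k.

Fact malg_skew x y : b x y = - b y x.
Proof.
apply: (malg_ext (g := b^~ y) (h := fun x => - b y x)) => [|a u v|k] //.
  by rewrite br opprD scalerN.
apply: (malg_ext (g := b 'b_k) (h := fun y => - b y 'b_k)) => // a u v.
by rewrite bl opprD scalerN.
Qed.

Lemma malg_alt x : b x x = 0.
Proof.
have b0 y : b y 0 = 0.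
  have : b y (1 *: 0 + 0) = 1 *: b y 0 + b y 0 by exact: br.
  by rewrite !scale1r addr0 => /eqP; rewrite -subr_eq subrr => /eqP <-.
rewrite [x]malg_basis; elim: (msupp x : seq K) => [|k s IH].
  by rewrite big_nil b0.
rewrite big_cons; set u := 'b_k; set y := \sum_(_ <- s) _ in IH *.
rewrite (bl _ (x@_k)) !br IH addr0 [b y u]malg_skew bkk scaler0 add0r.
by rewrite scalerN subrr.
Qed.
End Alternating.

End Extension.

Notation Aod_index := (int + int)%type.

(* inl r and inr r index the basis vectors L_r and M_r.  The bracket of three
   basis vectors is c *: 'b_m with (c, m) below: all the rearrangements of
   [L_r, L_s, M_t] and [L_r, M_s, M_t], with their signs. *)
Definition structure_constant (i j k : Aod_index) :
    int * Aod_index :=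
  match i, j, k with
  | inl r, inl s, inr t => (s - r, inl (r + s - t))
  | inl r, inr t, inl s => (r - s, inl (r + s - t))
  | inr t, inl r, inl s => (s - r, inl (r + s - t))
  | inl r, inr s, inr t => (t - s, inr (s + t - r))
  | inr s, inl r, inr t => (s - t, inr (s + t - r))
  | inr s, inr t, inl r => (t - s, inr (s + t - r))
  | _, _, _ => (0, inl 0)
  end.

Fact structure_constant_swap12 i j k :
  structure_constant j i k =
    (- (structure_constant i j k).1, (structure_constant i j k).2).
Proof.
case: i j k => r [] s [] t /=; rewrite ?oppr0 ?opprB //.
all: by rewrite (addrC s).
Qed.

Fact structure_constant_swap23 i j k :
  structure_constant i k j =
    (- (structure_constant i j k).1, (structure_constant i j k).2).
Proof.
case: i j k => r [] s [] t /=; rewrite ?oppr0 ?opprB //.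
all: by rewrite (addrC t).
Qed.

Section Algebra.
Variable F : fieldType.

(* A_omega^delta. *)
Definition Aod : Type := {malg F[Aod_index]}.
HB.instance Definition _ := GRing.Lmodule.on Aod.

Definition L (r : int) : Aod := 'b_(inl r).
Definition M (r : int) : Aod := 'b_(inr r).

Definition Aod_br (x y z : Aod) : Aod :=
  lext (fun i => lext (fun j => lext (fun k =>
    (structure_constant i j k).1%:~R *: 'b_(structure_constant i j k).2)
    z) y) x.

Lemma Aod_br_basis i j k :
  Aod_br 'b_i 'b_j 'b_k =
    (structure_constant i j k).1%:~R *: 'b_(structure_constant i j k).2.
Proof. by rewrite /Aod_br !lextU. Qed.

Fact Aod_linear1 y z : linear (fun x => Aod_br x y z).
Proof. exact: lext_is_linear. Qed.

Fact Aod_linear2 x z : linear (fun y => Aod_br x y z).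
Proof.
move=> a y y'; rewrite /Aod_br -lext_lin; apply: eq_lext => i.
exact: lext_is_linear.
Qed.

Fact Aod_linear3 x y : linear (Aod_br x y).
Proof.
move=> a z z'; rewrite /Aod_br -lext_lin; apply: eq_lext => i.
rewrite -lext_lin; apply: eq_lext => j; exact: lext_is_linear.
Qed.

Fact Aod_alt12 x z : Aod_br x x z = 0.
Proof.
apply: (malg_alt (b := fun x y => Aod_br x y z)) => [y|{}x|k|k l].
- exact: Aod_linear1.
- exact: Aod_linear2.
- apply: (malg_ext (g := Aod_br _ _) (h := fun=> 0)) => [|a u v|m].
  + exact: Aod_linear3.
  + by rewrite scaler0 addr0.
  by rewrite Aod_br_basis; case: k m => r [] s /=; rewrite ?subrr scale0r.
apply: (malg_ext (g := Aod_br _ _) (h := fun z => - Aod_br _ _ z)) => [|a u v|m].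
- exact: Aod_linear3.
- by rewrite Aod_linear3 opprD scalerN.
by rewrite !Aod_br_basis structure_constant_swap12 /= mulrNz scaleNr.
Qed.

Fact Aod_alt23 x y : Aod_br x y y = 0.
Proof.
apply: (malg_alt (b := Aod_br x)) => [z|z|k|k l].
- exact: Aod_linear2.
- exact: Aod_linear3.
- apply: (malg_ext (g := fun x => Aod_br x _ _) (h := fun=> 0)) => [|a u v|m].
  + exact: Aod_linear1.
  + by rewrite scaler0 addr0.
  by rewrite Aod_br_basis; case: k m => r [] s /=; rewrite ?subrr scale0r.
apply: (malg_ext (g := fun x => Aod_br x _ _)
                 (h := fun x => - Aod_br x _ _)) => [|a u v|m].
- exact: Aod_linear1.
- by rewrite Aod_linear1 opprD scalerN.
by rewrite !Aod_br_basis structure_constant_swap23 /= mulrNz scaleNr.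
Qed.

Fact Aod_fundamental_basis (i j k l m : Aod_index) :
  Aod_br 'b_i 'b_j (Aod_br 'b_k 'b_l 'b_m) =
    Aod_br (Aod_br 'b_i 'b_j 'b_k) 'b_l 'b_m
    + Aod_br 'b_k (Aod_br 'b_i 'b_j 'b_l) 'b_m
    + Aod_br 'b_k 'b_l (Aod_br 'b_i 'b_j 'b_m).
Proof.
have comb (n n0 n1 n2 n3 : Aod_index) (c0 c1 c2 c3 d0 d1 d2 d3 : int) :
    (c0 * d0 = 0 \/ n0 = n) -> (c1 * d1 = 0 \/ n1 = n) ->
    (c2 * d2 = 0 \/ n2 = n) -> (c3 * d3 = 0 \/ n3 = n) ->
    c0 * d0 = c1 * d1 + c2 * d2 + c3 * d3 ->
    c0%:~R *: (d0%:~R *: 'b_n0) = c1%:~R *: (d1%:~R *: 'b_n1)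
      + c2%:~R *: (d2%:~R *: 'b_n2) + c3%:~R *: (d3%:~R *: 'b_n3) :> Aod.
  have E n' c d : c * d = 0 \/ n' = n ->
      c%:~R *: (d%:~R *: 'b_n') = (c * d)%:~R *: 'b_n :> Aod.
    rewrite scalerA -intrM => -[-> | -> //]; by rewrite mulr0z !scale0r.
  by move=> /E-> /E-> /E-> /E-> ->; rewrite !intrD !scalerDl.
have Z1 y z := scalable_linear (Aod_linear1 y z).
have Z2 x z := scalable_linear (Aod_linear2 x z).
have Z3 x y := scalable_linear (Aod_linear3 x y).
rewrite !Aod_br_basis Z3 Z1 Z2 Z3 !Aod_br_basis {Z1 Z2 Z3}.
case: i j k l m => r [] s [] t [] u [] v; eapply comb;
  cbv beta iota delta [structure_constant fst snd].
all: try solve [left; rewrite ?mul0r ?mulr0; reflexivity].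
all: try solve [right; reflexivity].
all: try solve [right; apply: f_equal; ring].
all: try solve [ring].
Unshelve.
all: exact: (inl 0).
Qed.

Fact Aod_fundamental x1 x2 x3 x4 x5 :
  Aod_br x1 x2 (Aod_br x3 x4 x5) =
    Aod_br (Aod_br x1 x2 x3) x4 x5 + Aod_br x3 (Aod_br x1 x2 x4) x5
      + Aod_br x3 x4 (Aod_br x1 x2 x5).
Proof.
pose lhs x1 x2 x3 x4 x5 := Aod_br x1 x2 (Aod_br x3 x4 x5).
pose rhs x1 x2 x3 x4 x5 :=
  Aod_br (Aod_br x1 x2 x3) x4 x5 + Aod_br x3 (Aod_br x1 x2 x4) x5
  + Aod_br x3 x4 (Aod_br x1 x2 x5).
have add3 a (u v w u' v' w' : Aod) :
    (a *: u + u') + (a *: v + v') + (a *: w + w') =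
    a *: (u + v + w) + (u' + v' + w').
  by rewrite !scalerDr (addrACA (a *: u)) (addrACA (a *: u + _)).
have l1 := Aod_linear1; have l2 := Aod_linear2; have l3 := Aod_linear3.
rewrite -[LHS]/(lhs x1 x2 x3 x4 x5) -[RHS]/(rhs x1 x2 x3 x4 x5).
apply: (malg_ext (g := fun x => lhs x _ _ _ _) (h := fun x => rhs x _ _ _ _)).
- by move=> a u v; rewrite /lhs l1.
- by move=> a u v; rewrite /rhs !l1 l2 l3 add3.
move=> i {x1}.
apply: (malg_ext (g := fun x => lhs _ x _ _ _) (h := fun x => rhs _ x _ _ _)).
- by move=> a u v; rewrite /lhs l2.
- by move=> a u v; rewrite /rhs !l2 l1 l3 add3.
move=> j {x2}.
apply: (malg_ext (g := fun x => lhs _ _ x _ _) (h := fun x => rhs _ _ x _ _)).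
- by move=> a u v; rewrite /lhs l1 l3.
- by move=> a u v; rewrite /rhs l3 !l1 add3.
move=> k {x3}.
apply: (malg_ext (g := fun x => lhs _ _ _ x _) (h := fun x => rhs _ _ _ x _)).
- by move=> a u v; rewrite /lhs l2 l3.
- by move=> a u v; rewrite /rhs l3 !l2 add3.
move=> l {x4}.
apply: (malg_ext (g := lhs _ _ _ _) (h := rhs _ _ _ _)).
- by move=> a u v; rewrite /lhs !l3.
- by move=> a u v; rewrite /rhs !l3 add3.
by move=> m; exact: Aod_fundamental_basis.
Qed.

HB.instance Definition _ := isThreeLie.Build F Aod
  Aod_linear1 Aod_linear2 Aod_linear3 Aod_alt12 Aod_alt23 Aod_fundamental.

Lemma Aod_ext (U : lmodType F) (g h : Aod -> U) :
  linear g -> linear h -> (forall k, g 'b_k = h 'b_k) -> g =1 h.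
Proof. exact: malg_ext. Qed.

Lemma br3_LLM r s t : br3 (L r) (L s) (M t) = (s - r)%:~R *: L (r + s - t).
Proof. exact: Aod_br_basis. Qed.
Lemma br3_LMM r s t : br3 (L r) (M s) (M t) = (t - s)%:~R *: M (s + t - r).
Proof. exact: Aod_br_basis. Qed.
Lemma br3_LLL r s t : br3 (L r) (L s) (L t) = 0.
Proof. by rewrite [LHS]Aod_br_basis scale0r. Qed.
Lemma br3_MMM r s t : br3 (M r) (M s) (M t) = 0.
Proof. by rewrite [LHS]Aod_br_basis scale0r. Qed.

(* The basis p_r, q_r, x_r, z_r of ad(A_omega^delta). *)
Definition p_ (r : int) : ad_alg Aod :=
  if r == 0 then inn (L 0) (M 0)
  else 2^-1 *: (inn (L 0) (M (- r)) + inn (L r) (M 0)).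
Definition q_ (r : int) : ad_alg Aod :=
  if r == 0 then inn (L 0) (M 0) - inn (L 1) (M 1)
  else r%:~R^-1 *: (inn (L 0) (M (- r)) - inn (L r) (M 0)).
Definition x_ (r : int) : ad_alg Aod :=
  if r == 0 then 2^-1 *: inn (L 1) (L (- 1)) else r%:~R^-1 *: inn (L r) (L 0).
Definition z_ (r : int) : ad_alg Aod :=
  if r == 0 then 2^-1 *: inn (M 1) (M (- 1))
  else (- r)%:~R^-1 *: inn (M (- r)) (M 0).

(* The vector space with basis v_alpha, alpha in F. *)
Definition V : Type := {malg F[F]}.
HB.instance Definition _ := GRing.Lmodule.on V.
Definition v (alpha : F) : V := 'b_alpha.

(* psi = psi_{lambda,mu}: the values on the basis of ad(Aod). *)
Definition is_psi (lambda mu : F) (psi : {linear ad_alg Aod -> gl V}) : Prop :=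
  forall (r : int) (alpha : F),
    [/\ psi (p_ r) (v alpha) =
          (lambda + alpha - r%:~R * mu) *: v (alpha - r%:~R),
        psi (q_ r) (v alpha) = 0,
        psi (x_ r) (v alpha) = 0
      & psi (z_ r) (v alpha) = 0].

Lemma basis_values (charF : [pchar F] =i pred0) (U : lmodType F) (T : int -> U)
    (f : {linear ad_alg Aod -> U}) (r : int) :
  (forall r s, f (inn (L r) (L s)) = 0) ->
  (forall r s, f (inn (M r) (M s)) = 0) ->
  (forall r s, f (inn (L r) (M s)) = T (r - s)) ->
  [/\ f (p_ r) = T r, f (q_ r) = 0, f (x_ r) = 0 & f (z_ r) = 0].
Proof.
move=> LL MM LM.
have nat0 n : n%:R == 0 :> F = (n == 0)%N by move/pcharf0P: charF.
have rn0 : r != 0 -> r%:~R != 0 :> F.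
  case: r => n nz; first by rewrite -pmulrn nat0.
  by rewrite NegzE mulrNz oppr_eq0 -pmulrn nat0.
rewrite /p_ /q_ /x_ /z_; have [->|r0] := eqVneq r 0.
  by rewrite linearB !linearZZ !LM LL MM !subrr !scaler0.
rewrite !linearZZ linearD linearB !LM LL MM opprK add0r subr0.
rewrite subrr !scaler0; split => //.
by rewrite -mulr2n -scaler_nat scalerA mulVf ?nat0 // scale1r.
Qed.

Section PsiExists.
Variables lambda mu : F.

Let T_spec (T : int -> gl V) := forall r alpha,
  T r (v alpha) = (lambda + alpha - r%:~R * mu) *: v (alpha - r%:~R).

Fact T_exists : exists T, T_spec T.
Proof.
pose T r := lext (fun alpha =>
  (lambda + alpha - r%:~R * mu) *: v (alpha - r%:~R)).
have Tl r : linear (T r) by exact: lext_is_linear.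
pose T' r : {linear V -> V} :=
  HB.pack (T r) (GRing.isLinear.Build F V V *:%R (T r) (Tl r)).
by exists T' => r alpha; rewrite /= /T lextU.
Qed.

Section Construction.
Variables (T : int -> gl V) (Tv : T_spec T).

Let P (i j : Aod_index) : gl V :=
  match i, j with
  | inl r, inr s => T (r - s)
  | inr s, inl r => - T (r - s)
  | _, _ => 0
  end.

Let Phi (c : int) (x : Aod) : gl V :=
  lext (fun i => if i is inl r then T (r - c) else 0) x.

(* p_r L_0 = (r/2) L_r and p_r L_1 = (r/2 - 1) L_(r+1), while q_r, x_r and z_r
   contribute nothing to the difference defining psi below. *)
Fact psi_on_generators : exists psi : {linear ad_alg Aod -> gl V},
  forall i j, psi (inn ('b_i : Aod) ('b_j : Aod)) = P i j.
Proof.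
pose psi (D : ad_alg Aod) :=
  Phi 0 ((\val D : gl Aod) (L 0)) - Phi 1 ((\val D : gl Aod) (L 1)).
have Phil c : linear (Phi c) by exact: lext_is_linear.
have psil : linear psi.
  move=> a D E; rewrite /psi linearP !glE !Phil scalerBr opprD.
  by rewrite addrACA.
exists (HB.pack psi
  (GRing.isLinear.Build F (ad_alg Aod) (gl V) *:%R psi psil)
  : {linear ad_alg Aod -> gl V}) => i j.
rewrite /= /psi /= /ad_fun [X in Phi 0 X]Aod_br_basis [X in Phi 1 X]Aod_br_basis.
have Z c a k : Phi c (a *: 'b_k) = a *: (if k is inl r then T (r - c) else 0).
  by rewrite (scalable_linear (Phil c)) /Phi lextU.
rewrite !Z; case: i j => r [] s;
  cbv beta iota delta [structure_constant fst snd P]; rewrite ?scaler0 ?subr0 //.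
- by rewrite !mulr0z !scale0r subr0.
- rewrite (_ : r + 1 - s - 1 = r - s); last by ring.
  by rewrite intrB scalerBl opprB addrC subrK scale1r.
- rewrite (_ : s + 1 - r - 1 = s - r); last by ring.
  by rewrite -scalerBl -intrB (_ : 0 - s - (1 - s) = -1) ?scaleN1r //; ring.
Qed.

Fact T_comm a b : lie (T a) (T b) = (a - b)%:~R *: T (a + b).
Proof.
apply/glP; apply: malg_ext => [| | alpha].
- exact: (@linearP _ _ _ _ (lie (T a) (T b))).
- exact: (@linearP _ _ _ _ ((a - b)%:~R *: T (a + b))).
have Tu r beta : T r 'b_beta = _ := Tv r beta.
rewrite lieE glZE !Tu 2!linearZZ !Tv !scalerA.
rewrite (_ : alpha - b%:~R - a%:~R = alpha - (a + b)%:~R); last by ring.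
rewrite (_ : alpha - a%:~R - b%:~R = alpha - (a + b)%:~R); last by ring.
rewrite -scalerBl.
set c := (X in X *: _ = _); set d := (X in _ = X *: _).
by suff -> : c = d by []; rewrite /c /d; ring.
Qed.

Section Psi.
Variable psi : {linear ad_alg Aod -> gl V}.
Hypothesis psiE : forall i j, psi (inn ('b_i : Aod) ('b_j : Aod)) = P i j.

Fact psi_values (charF : [pchar F] =i pred0) : is_psi lambda mu psi.
Proof.
move=> r alpha.
have [] := @basis_values charF (gl V) T psi r.
- by move=> s t; exact: (psiE (inl s) (inl t)).
- by move=> s t; exact: (psiE (inr s) (inr t)).
- by move=> s t; exact: (psiE (inl s) (inr t)).
by move=> -> -> -> ->; rewrite -Tv.
Qed.

Fact psi_module : is_ad_module psi.
Proof.
move=> D E.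
apply: (ad_alg_ext (g := fun D => psi (ad_lie D E))
                   (h := fun D => lie (psi D) (psi E))) D.
- by move=> a f g; rewrite ad_lie_linearl linearP.
- by move=> a f g; rewrite linearP lie_linearl.
move=> x1 x2.
apply: (ad_alg_ext (g := fun E => psi (ad_lie _ E))
                   (h := fun E => lie _ (psi E))) E.
- by move=> a f g; rewrite ad_lie_linearr linearP.
- by move=> a f g; rewrite linearP lie_linearr.
move=> x3 x4.
apply: (Aod_ext (g := fun x => psi (ad_lie (inn x _) _))
                 (h := fun x => lie (psi (inn x _)) _)) x1 => [a x y|a x y|i].
- by rewrite inn_linearl ad_lie_linearl linearP.
- by rewrite inn_linearl linearP lie_linearl.
apply: (Aod_ext (g := fun x => psi (ad_lie (inn _ x) _))
                 (h := fun x => lie (psi (inn _ x)) _)) x2 => [a x y|a x y|j].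
- by rewrite inn_linearr ad_lie_linearl linearP.
- by rewrite inn_linearr linearP lie_linearl.
apply: (Aod_ext (g := fun x => psi (ad_lie _ (inn x _)))
                 (h := fun x => lie _ (psi (inn x _)))) x3 => [a x y|a x y|k].
- by rewrite inn_linearl ad_lie_linearr linearP.
- by rewrite inn_linearl linearP lie_linearr.
apply: (Aod_ext (g := fun x => psi (ad_lie _ (inn _ x)))
                 (h := fun x => lie _ (psi (inn _ x)))) x4 => [a x y|a x y|l].
- by rewrite inn_linearr ad_lie_linearr linearP.
- by rewrite inn_linearr linearP lie_linearr.
rewrite ad_lie_inn linearD.
have E1 a (x y : Aod) : psi (inn (a *: x) y) = a *: psi (inn x y).
  by rewrite (scalable_linear (inn_linearl y)) linearZZ.
have E2 a (x y : Aod) : psi (inn x (a *: y)) = a *: psi (inn x y).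
  by rewrite (scalable_linear (inn_linearr x)) linearZZ.
rewrite [br3 _ _ ('b_k : Aod)]Aod_br_basis [br3 _ _ ('b_l : Aod)]Aod_br_basis E1 E2.
rewrite !psiE {E1 E2}.
have comm (c d a b e e' : int) : e = a + b -> e' = a + b -> c + d = a - b ->
    c%:~R *: T e + d%:~R *: T e' = T a * T b - T b * T a.
  by move=> -> -> cd; rewrite -scalerDl -intrD cd -T_comm.
have canc (c e e' : int) : e = e' -> c%:~R *: T e - c%:~R *: T e' = 0.
  by move=> ->; rewrite subrr.
case: i j k l => r [] s [] t [] u;
  cbv beta iota delta [structure_constant fst snd P].
all: rewrite ?mulr0z ?scale0r ?scaler0 ?addr0 ?add0r ?scalerN.
all: rewrite /lie ?(mulNr, mulrN, mul0r, mulr0, subr0, oppr0, opprK) //.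
all: rewrite ?addr0 // -?scaleNr -?mulrNz.
all: lazymatch goal with
  | |- _ = 0 => rewrite ?mulrNz ?scaleNr; by [apply: canc; ring
                                             | rewrite addrC; apply: canc; ring]
  | |- _ => by [apply: comm; ring | rewrite [RHS]addrC; apply: comm; ring]
  end.
Qed.

End Psi.
End Construction.

(* The defining equations of psi_{lambda,mu} are consistent. *)
Lemma psi_exists (charF : [pchar F] =i pred0) :
  exists psi : {linear ad_alg Aod -> gl V},
    is_psi lambda mu psi /\ is_ad_module psi.
Proof.
have [T Tv] := T_exists; have [psi psiE] := psi_on_generators T.
by exists psi; split; [exact: psi_values Tv _ psiE _ | exact: psi_module Tv _ psiE].
Qed.

End PsiExists.

End Algebra.

(* Main.v *)
Require Import Defs.
From HB Require Import structures.
From mathcomp Require Import all_boot all_order all_algebra.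
From mathcomp Require Import ring.

Import GRing.Theory.
Local Open Scope ring_scope.

(** Suppose that psi is induced by a module rho, and write T_r for psi (p_ r).
    Since q_r and z_r act by zero, rho(M_1, M_0) vanishes, while rho(L_0, M_0)
    and rho(L_1, M_1) are both T_0, rho(L_0, M_1) is T_(-1) and rho(L_1, M_0)
    is T_1.  The second module axiom at (L_1, L_0, M_1, M_0), where
    [L_1, L_0, M_1] = - L_0, then says

      - T_0 = T_(-1) T_1 - T_0 T_0.

    This constrains a product of operators, where the ad(A)-module axiom only
    constrains commutators.  On v_0 it reads

      - lambda = (lambda - mu) (lambda - 1 + mu) - lambda ^ 2,

    that is mu (1 - mu) = 0. *)

Lemma scale_v_inj (F : fieldType) (alpha : F) :
  injective (fun c : F => c *: v alpha).
Proof.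
(* The sum of the coordinates is a linear form that takes the value 1 on
   every basis vector. *)
pose sum_coords : {linear V F -> F^o} := lext (fun=> 1 : F^o).
have sum_coordsZ (c : F) : sum_coords (c *: v alpha) = c.
  by rewrite linearZ_LR /= lextU; exact: mulr1.
by move=> c d /(congr1 sum_coords); rewrite !sum_coordsZ.
Qed.

Section Generators.
Variables (F : fieldType) (charF : [pchar F] =i pred0) (lambda mu : F).
Variables (psi : {linear ad_alg (Aod F) -> gl (V F)}).
Hypothesis psiE : is_psi lambda mu psi.

Let intr_neq0 (r : int) : r != 0 -> r%:~R != 0 :> F.
Proof.
have nat0 n : n%:R == 0 :> F = (n == 0)%N by move/pcharf0P: charF.
case: r => n nz; first by rewrite -pmulrn nat0.
by rewrite NegzE mulrNz oppr_eq0 -pmulrn nat0.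
Qed.

Let psiZ a D w : psi (a *: D) w = a *: psi D w.
Proof. by rewrite linearZZ. Qed.
Let psiD D E w : psi (D + E) w = psi D w + psi E w.
Proof. by rewrite linearD. Qed.
Let psiB D E w : psi (D - E) w = psi D w - psi E w.
Proof. by rewrite linearB glBE. Qed.

(** The two elements of ad(A) are p_r + (r/2) q_r and p_r - (r/2) q_r, and q_r
    acts by zero. *)
Lemma psi_LM (r : int) (alpha : F) : r != 0 ->
  psi (inn (L F 0) (M F (- r))) (v alpha) = psi (p_ F r) (v alpha) /\
  psi (inn (L F r) (M F 0)) (v alpha) = psi (p_ F r) (v alpha).
Proof.
move=> r0; have [_ + _ _] := psiE r alpha.
rewrite /p_ /q_ (negbTE r0) !psiZ psiB psiD => /eqP.
rewrite scaler_eq0 invr_eq0 (negbTE (intr_neq0 _ r0)) /= subr_eq0 => /eqP ->.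
have two0 : 2 != 0 :> F by exact: (intr_neq0 2).
by rewrite -mulr2n -scaler_nat scalerA mulVf // scale1r.
Qed.

Lemma psi_L0M0 (alpha : F) :
  psi (inn (L F 0) (M F 0)) (v alpha) = psi (p_ F 0) (v alpha).
Proof. by rewrite /p_ eqxx. Qed.

Lemma psi_L1M1 (alpha : F) :
  psi (inn (L F 1) (M F 1)) (v alpha) = psi (p_ F 0) (v alpha).
Proof.
have [_ + _ _] := psiE 0 alpha; rewrite /q_ eqxx psiB => /eqP.
by rewrite subr_eq0 psi_L0M0 => /eqP.
Qed.

Lemma psi_M1M0 (alpha : F) : psi (inn (M F 1) (M F 0)) (v alpha) = 0.
Proof.
have [_ _ _] := psiE (- 1) alpha.
by rewrite /z_ /= psiZ opprK invr1 scale1r.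
Qed.

End Generators.

Lemma module_skew (F : fieldType) (B : threeLieType F) (W : lmodType F)
    (rho : B -> B -> gl W) (x y : B) :
  is_3Lie_module rho -> rho x y = - rho y x.
Proof.
case=> linl linr alt _ _; apply/eqP; rewrite -addr_eq0.
have := alt (1 *: x + y); rewrite linl linr [rho y _]linr !alt !scale1r.
by rewrite addr0 add0r => /eqP.
Qed.

Theorem mainTheorem6 (F : fieldType) (charF : [pchar F] =i pred0)
    (lambda mu : F) (psi : {linear ad_alg (Aod F) -> gl (V F)})
    (psiE : is_psi lambda mu psi) (mu_neq0 : mu != 0) (mu_neq1 : mu != 1) :
  ~ is_induced psi.
Proof.
move=> [rho [rhoM _ psi_rho]].
have [linl _ _ _ assoc] := rhoM.
have pE r alpha : psi (p_ F r) (v alpha) =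
    (lambda + alpha - r%:~R * mu) *: v (alpha - r%:~R).
  by case: (psiE r alpha).
have [L0M1 _] := psi_LM _ charF _ _ _ psiE (- 1) (- 1) isT.
have [_ L1M0] := psi_LM _ charF _ _ _ psiE 1 0 isT.
have rhoZ a x y w : rho (a *: x) y w = a *: rho x y w.
  by rewrite (scalable_linear (linl y)).
have rho_scale x y (c : F) (w : V F) : rho x y (c *: w) = c *: rho x y w.
  exact: linearZ_LR.
have rho0 x y : rho x y (0 : V F) = 0 by exact: raddf0.
have /(congr1 (fun f : gl (V F) => f (v 0))) :=
  assoc (L F 1) (L F 0) (M F 1) (M F 0).
rewrite br3_LLM rhoZ !(glDE, glME).
rewrite (module_skew _ _ _ _ (M F 1) (L F 1) rhoM) glNE.
rewrite -(psi_rho (M F 1)) (psi_M1M0 _ _ _ _ psiE) rho0.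
rewrite -(psi_rho _ (M F 0)) -(psi_rho (L F 1) (M F 0)) L1M0 psi_L0M0 !pE.
rewrite (_ : 0 - 0%:~R = 0 :> F); last by rewrite subr0.
rewrite (_ : 0 - 1%:~R = -1 :> F); last by rewrite sub0r.
rewrite !rho_scale -!psi_rho L0M1 (psi_L1M1 _ _ _ _ psiE) !pE.
rewrite (_ : -1 - (-1)%:~R = 0 :> F); last by rewrite subrr.
rewrite (_ : 0 - 0%:~R = 0 :> F); last by rewrite subr0.
rewrite add0r !scalerA -scalerBl => /scale_v_inj coef_eq.
have /eqP : mu * (mu - 1) = 0.
  apply/eqP; move/eqP: coef_eq; rewrite -subr_eq0.
  by congr (_ == 0); ring.
by rewrite mulf_eq0 subr_eq0 (negbTE mu_neq0) (negbTE mu_neq1).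
Qed.
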